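(* Let $G(t,v)=\sum_{n\ge 2}\sum_{d\ge 0}\#F_n^d\,v^d t^n$, where $F_n^d$ is the set of permutations of $[n]$ with exactly $d$ kinks beyond the initial one (as defined in the context). Then $$G(t,v)=\sum_{j\ge 0}\frac{4t^{2}\sqrt{1-v}\,\bigl(1-(1+2j)\sqrt{1-v}\,t-t(1-v)\bigr)v^{j}}{(1+\sqrt{1-v})^{1+2j}\,(1-2jt\sqrt{1-v})^{2}\,(1-2(j+1)t\sqrt{1-v})^{2}}.$$
   Context: Let $[n]=\{1,\dots,n\}$ and let $S_n$ be the set of permutations of $[n]$, written as words $\pi=\pi_1\pi_2\cdots\pi_n$ with $\pi_i=\pi(i)$. A permutation is viewed as a history on the path with vertices $1,\dots,n$ (with $i$ adjacent to $i+1$), where at time $i$ the vertex $\pi_i$ is flipped. An index $i$ with $2\le i\le n$ is an (extra) kink creation if no vertex adjacent to $\pi_i$ was flipped earlier, i.e. there is no $k<i$ with $\pi_k=\pi_i-1$ or $\pi_k=\pi_i+1$. For $d\ge 0$, $F_n^d$ denotes the set of $\pi\in S_n$ having exactly $d$ such indices $i\in\{2,\dots,n\}$ (the initial flip $i=1$ is not counted). $\#F_n^d$ is its cardinality. The identity is one of formal power series in $t$ and $v$, where $\sqrt{1-v}$ is the power series in $v$ with constant term $1$; the infinite sum makes sense because the $j$-th term is divisible by $v^j$. *)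

(* Defs.v *)
From HB Require Import structures.
From mathcomp Require Import all_boot all_order all_fingroup all_algebra.
From mathcomp Require Import boolp.

Set Implicit Arguments.
Unset Strict Implicit.
Unset Printing Implicit Defensive.

Import GRing.Theory.
Local Open Scope ring_scope.

Record fps (R : Type) := Fps { fps_coef :> nat -> R }.

Notation "{ 'fps' R }" := (fps R) (at level 0, format "{ 'fps'  R }").

Lemma fpsP (R : Type) (f g : {fps R}) : (forall n, f n = g n) <-> f = g.
Proof.
split=> [|-> //]; case: f g => [f] [g] /= fg.
by congr Fps; apply: funext.
Qed.

HB.instance Definition _ (R : Type) := gen_eqMixin {fps R}.
HB.instance Definition _ (R : Type) := gen_choiceMixin {fps R}.

(* Course-of-values recursion: F n g should only read g 0, ..., g (n - 1).   *)
Section CourseOfValues.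
Variables (T : Type) (x0 : T) (F : nat -> (nat -> T) -> T).

Fixpoint cov_prefix (n : nat) : seq T :=
  if n is m.+1 then
    let s := cov_prefix m in rcons s (F m (nth x0 s))
  else [::].

Definition cov_rec (n : nat) : T := nth x0 (cov_prefix n.+1) n.

Lemma size_cov_prefix n : size (cov_prefix n) = n.
Proof. by elim: n => //= n IHn; rewrite size_rcons IHn. Qed.

Lemma nth_cov_prefix n i : (i < n)%N -> nth x0 (cov_prefix n) i = cov_rec i.
Proof.
elim: n => // n IHn; rewrite ltnS leq_eqVlt => /orP[/eqP-> //|lt_in].
by rewrite /= nth_rcons size_cov_prefix lt_in IHn.
Qed.

Lemma cov_recE n :
    (forall g h, (forall i, (i < n)%N -> g i = h i) -> F n g = F n h) ->
  cov_rec n = F n cov_rec.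
Proof.
move=> Fext; rewrite /cov_rec /= nth_rcons size_cov_prefix ltnn eqxx.
by apply: Fext => i lt_in; rewrite nth_cov_prefix.
Qed.

End CourseOfValues.

Section FpsZmodule.
Variable R : zmodType.
Implicit Types f g h : {fps R}.

Definition fps_zero : {fps R} := Fps (fun=> 0).
Definition fps_opp f : {fps R} := Fps (fun n => - f n).
Definition fps_add f g : {fps R} := Fps (fun n => f n + g n).

Fact fps_addA : associative fps_add.
Proof. by move=> f g h; apply/fpsP => n /=; rewrite addrA. Qed.

Fact fps_addC : commutative fps_add.
Proof. by move=> f g; apply/fpsP => n /=; rewrite addrC. Qed.

Fact fps_add0 : left_id fps_zero fps_add.
Proof. by move=> f; apply/fpsP => n /=; rewrite add0r. Qed.

Fact fps_addN : left_inverse fps_zero fps_opp fps_add.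
Proof. by move=> f; apply/fpsP => n /=; rewrite addNr. Qed.

HB.instance Definition _ := GRing.isZmodule.Build {fps R}
  fps_addA fps_addC fps_add0 fps_addN.

Lemma coef_fps0 n : (0 : {fps R}) n = 0. Proof. by []. Qed.
Lemma coef_fpsN f n : (- f) n = - f n. Proof. by []. Qed.
Lemma coef_fpsD f g n : (f + g) n = f n + g n. Proof. by []. Qed.
Lemma coef_fpsB f g n : (f - g) n = f n - g n. Proof. by []. Qed.

Lemma coef_fps_sum I (r : seq I) (P : pred I) (u : I -> {fps R}) n :
  (\sum_(i <- r | P i) u i) n = \sum_(i <- r | P i) u i n.
Proof. by elim/big_rec2: _ => // i x y _ <-. Qed.

Definition fpsC (c : R) : {fps R} := Fps (fun n => if n == 0%N then c else 0).

End FpsZmodule.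

Section FpsRing.
Variable R : comNzRingType.
Implicit Types f g h : {fps R}.

Definition fpsX : {fps R} := Fps (fun n => (n == 1%N)%:R).

Definition fps_mul f g : {fps R} :=
  Fps (fun n => \sum_(i < n.+1) f i * g (n - i)%N).

Fact coef_fps_mul f g n : fps_mul f g n = \sum_(i < n.+1) f i * g (n - i)%N.
Proof. by []. Qed.

Fact fps_mulC : commutative fps_mul.
Proof.
move=> f g; apply/fpsP => n /=; rewrite (reindex_inj rev_ord_inj) /=.
by apply: eq_bigr => i _; rewrite mulrC !subSS subKn ?leq_ord.
Qed.

Fact coef_fps_mul_rev f g n :
  fps_mul f g n = \sum_(i < n.+1) f (n - i)%N * g i.
Proof.
by rewrite fps_mulC /=; apply: eq_bigr => i _; rewrite mulrC.
Qed.

Fact fps_mulA : associative fps_mul.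
Proof.
move=> p q r; apply/fpsP => i.
rewrite coef_fps_mul coef_fps_mul_rev.
pose coef3 j k := p j * (q (i - j - k)%N * r k).
transitivity (\sum_(j < i.+1) \sum_(k < i.+1 | (k <= i - j)%N) coef3 j k).
  apply: eq_bigr => j _; rewrite coef_fps_mul_rev big_distrr /=.
  by rewrite (big_ord_narrow_leq (leq_subr _ _)).
rewrite (exchange_big_dep predT) //=; apply: eq_bigr => k _.
transitivity (\sum_(j < i.+1 | (j <= i - k)%N) coef3 j k).
  apply: eq_bigl => j; rewrite -ltnS -(ltnS j) -!subSn ?leq_ord //.
  by rewrite -subn_gt0 -(subn_gt0 j) -!subnDA addnC.
rewrite (big_ord_narrow_leq (leq_subr _ _)) big_distrl /=.
by apply: eq_bigr => j _; rewrite /coef3 -!subnDA addnC mulrA.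
Qed.

Fact fps_mul1 : left_id (fpsC 1) fps_mul.
Proof.
move=> f; apply/fpsP => n /=; rewrite big_ord_recl /= subn0 mul1r.
by rewrite big1 ?addr0 // => i _; rewrite mul0r.
Qed.

Fact fps_mulDl : left_distributive fps_mul +%R.
Proof.
move=> f g h; apply/fpsP => n /=; rewrite -big_split /=.
by apply: eq_bigr => i _; rewrite mulrDl.
Qed.

Fact fps_one_neq0 : fpsC (1 : R) != 0.
Proof. by apply/eqP => /fpsP/(_ 0%N) /= /eqP; rewrite oner_eq0. Qed.

HB.instance Definition _ := GRing.Zmodule_isComNzRing.Build {fps R}
  fps_mulA fps_mulC fps_mul1 fps_mulDl fps_one_neq0.

Lemma coef_fps1 n : (1 : {fps R}) n = (n == 0%N)%:R.
Proof. by rewrite /=; case: eqP. Qed.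

Lemma coef_fpsM f g n : (f * g) n = \sum_(i < n.+1) f i * g (n - i)%N.
Proof. by []. Qed.

Lemma coef0_fpsM f g : (f * g) 0%N = f 0%N * g 0%N.
Proof. by rewrite coef_fpsM big_ord1. Qed.

Fact fpsC_is_zmod_morphism : zmod_morphism (@fpsC R).
Proof. by move=> a b; apply/fpsP => -[|n] //=; rewrite subr0. Qed.

Fact fpsC_is_monoid_morphism : monoid_morphism (@fpsC R).
Proof.
split=> // a b; apply/fpsP => n; rewrite coef_fpsM big_ord_recl /= subn0.
rewrite big1 ?addr0 => [|i _]; last by rewrite mul0r.
by case: n => //= n; rewrite mulr0.
Qed.

HB.instance Definition _ := GRing.isZmodMorphism.Build R {fps R} (@fpsC R)
  fpsC_is_zmod_morphism.
HB.instance Definition _ := GRing.isMonoidMorphism.Build R {fps R} (@fpsC R)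
  fpsC_is_monoid_morphism.

End FpsRing.

Arguments fpsX {R}.

Section FpsUnitRing.
Variable R : comUnitRingType.
Implicit Types f g h : {fps R}.

Definition fps_unit : {pred {fps R}} :=
  [pred f : {fps R} | f 0%N \is a GRing.unit].

Definition fps_inv_step f (n : nat) (g : nat -> R) : R :=
  if n == 0%N then (f 0%N)^-1
  else - (f 0%N)^-1 * \sum_(i < n) g i * f (n - i)%N.

(* The value outside the units is the convention of unitRingType. *)
Definition fps_inv f : {fps R} :=
  if f \in fps_unit then Fps (cov_rec 0 (fps_inv_step f)) else f.

Fact fps_mulV : {in fps_unit, left_inverse 1 fps_inv *%R}.
Proof.
move=> f Uf; rewrite /fps_inv Uf; apply/fpsP => n.
rewrite coef_fpsM coef_fps1 big_ord_recr /= subnn.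
rewrite cov_recE => [|g h eq_gh]; last first.
  rewrite /fps_inv_step; case: ifP => // _; congr (_ * _).
  by apply: eq_bigr => i _; rewrite eq_gh.
rewrite /fps_inv_step; case: eqP => [->|_]; first by rewrite big_ord0 add0r mulVr.
by rewrite mulrAC mulNr mulVr // mulN1r subrr.
Qed.

Fact fps_unitPl f g : g * f = 1 -> fps_unit f.
Proof.
move/fpsP/(_ 0%N); rewrite coef0_fpsM /= => gf1.
by apply/unitrPr; exists (g 0%N); rewrite mulrC.
Qed.

Fact fps_inv_out : {in [predC fps_unit], fps_inv =1 id}.
Proof. by move=> f; rewrite inE /fps_inv => /negPf->. Qed.

HB.instance Definition _ := GRing.ComNzRing_hasMulInverse.Build {fps R}
  fps_mulV fps_unitPl fps_inv_out.

Lemma fps_unitE f : (f \is a GRing.unit) = (f 0%N \is a GRing.unit).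
Proof. by []. Qed.

(* The square root with constant term 1, meant for f 0 = 1 and 2 a unit.     *)
Definition fps_sqrt_step f (n : nat) (g : nat -> R) : R :=
  if n == 0%N then 1
  else (f n - \sum_(1 <= i < n) g i * g (n - i)%N) / 2%:R.

Definition fps_sqrt f : {fps R} := Fps (cov_rec 0 (fps_sqrt_step f)).

Lemma fps_sqrtE f n : fps_sqrt f n = fps_sqrt_step f n (fps_sqrt f).
Proof.
rewrite /= cov_recE // => g h eq_gh; rewrite /fps_sqrt_step; case: ifP => // _.
congr ((_ - _) / _); apply: eq_big_nat => i /andP[i_gt0 lt_in].
rewrite !eq_gh // ltn_subrL i_gt0; exact: leq_ltn_trans lt_in.
Qed.

Lemma coef0_fps_sqrt f : fps_sqrt f 0%N = 1. Proof. by []. Qed.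

Lemma sqr_fps_sqrt f :
  (2%:R : R) \is a GRing.unit -> f 0%N = 1 -> fps_sqrt f ^+ 2 = f.
Proof.
move=> U2 f0; apply/fpsP => -[|n]; first by rewrite expr2 coef0_fpsM mulr1 f0.
rewrite expr2 coef_fpsM big_ord_recl big_ord_recr subn0 coef0_fps_sqrt mul1r.
rewrite [X in fps_sqrt f X * _]/= /bump leq0n add1n subnn coef0_fps_sqrt mulr1.
set s := \sum_(i < n) _.
rewrite addrCA -mulr2n fps_sqrtE /fps_sqrt_step /= -[_ *+ 2]mulr_natr divrK //.
rewrite big_add1 big_mkord addrC -/s; apply: subrK.
Qed.

End FpsUnitRing.

(* R[[t,v]] is encoded as R[[v]][[t]]: f n d is the coefficient of t^n v^d.  *)
Definition tvar (R : comNzRingType) : {fps {fps R}} := fpsX.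
Definition vvar (R : comNzRingType) : {fps {fps R}} := fpsC fpsX.

(* Convergence of the partial sums to S for the product of the discrete      *)
(* topologies on the coefficients.                                           *)
Definition fps2_sums_to (R : comNzRingType) (u : nat -> {fps {fps R}})
    (S : {fps {fps R}}) : Prop :=
  forall n d : nat, exists N : nat, forall m : nat, (N <= m)%N ->
    (\sum_(j < m) u j) n d = S n d.

Lemma fps2_sums_to_unique (R : comNzRingType) (u : nat -> {fps {fps R}})
    (S T : {fps {fps R}}) :
  fps2_sums_to u S -> fps2_sums_to u T -> S = T.
Proof.
move=> uS uT; apply/fpsP => n; apply/fpsP => d.
have [N NP] := uS n d; have [M MP] := uT n d.
by rewrite -(NP (maxn N M)) ?leq_maxl // MP // leq_maxr.
Qed.

(* sqrt(1 - v), as a series in v, viewed in Q[[v]][[t]]. *)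
Definition sqrt1v : {fps {fps rat}} := fpsC (fps_sqrt (1 - fpsX)).

Lemma sqr_sqrt1v : sqrt1v ^+ 2 = 1 - vvar rat.
Proof.
by rewrite -rmorphXn sqr_fps_sqrt ?rmorphB ?rmorph1.
Qed.

Lemma coef0_sqrt1v : sqrt1v 0%N 0%N = 1. Proof. by []. Qed.

Lemma summand_denom_unit (j : nat) :
  (1 + sqrt1v) ^+ (1 + 2 * j) * (1 - (2 * j)%:R * tvar rat * sqrt1v) ^+ 2
    * (1 - (2 * (j + 1))%:R * tvar rat * sqrt1v) ^+ 2 \is a GRing.unit.
Proof.
have U k : 1 - k%:R * tvar rat * sqrt1v \is a GRing.unit.
  rewrite fps_unitE coef_fpsB !coef0_fpsM /tvar [fpsX _]/= mulr0 mul0r subr0.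
  exact: unitr1.
have Us : 1 + sqrt1v \is a GRing.unit by [].
have UX (x : {fps {fps rat}}) k :
  x \is a GRing.unit -> x ^+ k \is a GRing.unit by exact: unitrX.
have UM (x y : {fps {fps rat}}) : x \is a GRing.unit -> y \is a GRing.unit ->
  x * y \is a GRing.unit by move=> Ux Uy; rewrite unitrM Ux.
by apply: (UM); [apply: (UM)|]; apply: UX.
Qed.

(* Times and vertices are numbered from 0, so the initial flip is i = 0.     *)
Definition extra_kink (n : nat) (p : 'S_n) (i : 'I_n) : bool :=
  (0 < i)%N &&
  ~~ [exists k : 'I_n, (k < i)%N &&
        (((p k).+1 == p i :> nat) || (p k == (p i).+1 :> nat))].

Definition kinkF (n d : nat) : {set 'S_n} :=
  [set p : 'S_n | #|[set i : 'I_n | extra_kink p i]| == d].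

Definition kinkG : {fps {fps rat}} :=
  Fps (fun n => Fps (fun d => if (2 <= n)%N then #|kinkF n d|%:R else 0)).

(* Main.v *)
From HB Require Import structures.
Require Import Defs.
From mathcomp Require Import all_boot all_order all_fingroup all_algebra.
From mathcomp Require Import zify ring.

Set Implicit Arguments.
Unset Strict Implicit.
Unset Printing Implicit Defensive.

Import GRing.Theory.
Local Open Scope ring_scope.

(** Write s = sqrt (1 - v), w = 1 / (1 + s) and z = (1 - s) w, so that
z = v w^2 is divisible by v. The proof meets in the middle, at the numbers

  H_n = (2 s)^(n+1) w^2 sum_k (k+1)^n z^k,

which are the Eulerian power sums after the substitution v = 4 z / (1 + z)^2.

Kinks to H_n. A vertex is a kink, the initial flip included, exactly when its
flip time is a local minimum of the inverse permutation. Removing the last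
flip from a history on n + 1 vertices leaves a history on n vertices and a
gap, among n + 1, into which the last flipped vertex was inserted. Insertion
creates one more local minimum or none, and none happens for exactly two gaps
per local minimum ([sum_creates]). Hence P_n, the sum of v^(kinks) over S_n,
satisfies

  P_(n+1) = (2 + (n - 1) v) P_n + theta P_n,    theta = 2 (1 - v) v d/dv

([kink_poly_rec]). As theta multiplies s, w, z by - v, s (1 - s), 2 s
respectively, each term of H_n has an explicit logarithmic derivative and H_n
obeys the same recurrence ([euler_sum_rec]); also P_1 = H_1 = 1. So
P_n = H_n for n >= 1.

H_n to the stated sum. Put e_j = 1 / (1 - 2 j s t). The j-th summand equals
2 s t^2 z^j (z e_j e_(j+1)^2 + e_j^2 e_(j+1)) ([summand_pole]). The relation
e_j e_(j+1) = (j + 1) e_(j+1) - j e_j ([pole_mul]) linearises the products,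
and the sum telescopes into sum_k 8 s^3 w^2 (k+1)^2 z^k t^2 e_(k+1), whose
coefficient of t^n is H_n for n >= 2 ([rest_step], [sum_summand]).

All infinite sums are replaced by their first m terms. The truncations of H_n
satisfy the recurrence exactly, and both H_1 and the telescoping are then off
by multiples of z^m, hence of v^m, which do not affect coefficients of v^d
with d < m. *)

(** * Local minima and insertion of a maximum *)

(** A sequence of length [n] enters only through its rises and falls: [w g]
tells whether it rises across gap [g], the gap between positions [g - 1] and
[g]. A local minimum at [i] is a fall at gap [i] and a rise at gap [i + 1]. *)
Definition valleys (n : nat) (w : nat -> bool) : nat :=
  (\sum_(0 <= i < n) (~~ w i && w i.+1))%N.

(** Whether inserting a new maximum at gap [x] creates a local minimum. The
only candidate is the larger of the two entries that get separated, and it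
becomes a local minimum unless it was a local maximum before. At
the two ends nothing gets separated. *)
Definition creates (n : nat) (w : nat -> bool) (x : nat) : bool :=
  [&& 0 < x, x < n & if w x then w x.+1 else ~~ w x.-1]%N.

(** Switches from fall to rise and from rise to fall alternate, so their
numbers differ only through the boundary values. *)
Lemma valleys_peaks n w :
  (valleys n w + w 0 = \sum_(0 <= i < n) (w i && ~~ w i.+1) + w n)%N.
Proof.
rewrite /valleys; elim: n => [|n IHn]; first by rewrite !big_geq.
rewrite !big_nat_recr //=; move: IHn.
by case: (w n); case: (w n.+1); case: (w 0%N); lia.
Qed.

(** The hypotheses on [w'] describe the insertion of a new maximum at gap [x]:
the gap [x] is replaced by a rise followed by a fall, except that the first
gap always falls and the last gap always rises. *)
Lemma valleys_insert n w w' x : (0 < n)%N -> (x <= n)%N ->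
    w 0%N = false -> w n = true ->
    (forall g, (g < x)%N -> w' g = w g) ->
    w' x = (0 < x)%N -> w' x.+1 = (x == n) ->
    (forall g, (x < g)%N -> w' g.+1 = w g) ->
  valleys n.+1 w' = (valleys n w + creates n w x)%N.
Proof.
move=> n0 xn w0 wn wlt wx wSx wgt; rewrite /valleys /creates.
case: x xn wlt wx wSx wgt => [|y] xn wlt wx wSx wgt.
  rewrite big_nat_recl // wx wSx eq_sym (gtn_eqF n0) /= add0n addn0.
  apply: eq_big_nat => -[|i] _; rewrite ?wSx ?wgt // w0.
  by rewrite eq_sym (gtn_eqF n0).
move: xn; rewrite leq_eqVlt => /orP[/eqP xn|lt_xn].
  subst n; rewrite ltnn /= addn0 !big_nat_recr //= wx wn wlt // !addn0.
  congr (_ + _)%N.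
  by apply: eq_big_nat => i /andP[_ lt_i]; rewrite !wlt // ltnW.
(* Away from the ends only the terms around gap [y.+1] change. *)
have {n n0 wn lt_xn wSx} [r -> wSx] :
    exists2 r, n = (y.+2 + r)%N & w' y.+2 = false.
  exists (n - y.+2)%N; first by rewrite subnKC.
  by rewrite wSx; lia.
have bigc m f (k : nat) : (k <= m)%N ->
   (\sum_(0 <= i < m) f i = \sum_(0 <= i < k) f i + \sum_(k <= i < m) f i)%N.
  by move=> km; rewrite -big_cat_nat.
rewrite (bigc (y.+2 + r).+1 _ y) ?(bigc (y.+2 + r) _ y)%N; try lia.
rewrite -addnA; congr (_ + _)%N.
  by apply: eq_big_nat => i /andP[_ lt_i]; rewrite !wlt //; lia.
rewrite 3?[in LHS]big_ltn 2?[in RHS]big_ltn; try lia.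
rewrite big_add1 /= wx wSx wgt // wlt //= ltn_addr //.
have -> : (\sum_(y.+2 <= i < y.+2 + r) (~~ w' i.+1 && w' i.+2) =
           \sum_(y.+2 <= i < y.+2 + r) (~~ w i && w i.+1))%N.
  by apply: eq_big_nat => i /andP[lt_i _]; rewrite !wgt //; lia.
by case: (w y); case: (w y.+1); case: (w y.+2) => /=; lia.
Qed.

(** The harmless gaps are the two ends and the two gaps around each local
maximum; local maxima are one fewer than local minima. *)
Lemma sum_creates n w : (0 < n)%N -> w 0%N = false -> w n = true ->
  (\sum_(x < n.+1) creates n w x + (valleys n w).*2 = n.+1)%N.
Proof.
case: n => // n _ w0 wn; have := valleys_peaks n.+1 w.
rewrite w0 wn addn0 addn1 => ->.
rewrite -(big_mkord xpredT (fun x => nat_of_bool (creates n.+1 w x))).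
rewrite big_nat_recl // big_nat_recr //= /creates ltnn ltn0Sn /= addn0 add0n.
rewrite doubleS -addnn.
rewrite {1}big_nat_recl // w0 add0n big_nat_recr //= wn andbF addn0.
rewrite !addnS; congr _.+2.
rewrite -!big_split /= -[RHS]subn0 -[RHS]muln1 -sum_nat_const_nat.
apply: eq_big_nat => i /andP[_ lt_in]; rewrite ltnS lt_in /=.
by case: (w i); case: (w i.+1); case: (w i.+2).
Qed.

(** * Kinks as local minima of the flip times *)

Section FlipTime.
Variable n : nat.
Implicit Types (p : 'S_n).

Definition flip_time p (g : nat) : nat :=
  if insub g is Some x then val ((p^-1)%g x : 'I_n) else 0%N.

Lemma flip_timeK p (k : 'I_n) : flip_time p (p k) = k.
Proof. by rewrite /flip_time valK permK. Qed.

Lemma flip_timeP p g : (g < n)%N ->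
  exists2 k : 'I_n, p k = g :> nat & flip_time p g = k.
Proof.
move=> lt_g; exists ((p^-1)%g (Ordinal lt_g)); first by rewrite permKV.
by rewrite /flip_time insubT.
Qed.

(** Virtual vertices beyond both ends of the path count as flipped after all
the others, so that gap 0 falls and gap [n] rises; then a missing neighbour
never prevents a local minimum. *)
Definition rises p (g : nat) : bool :=
  (n <= g)%N || ((0 < g) && (flip_time p g.-1 < flip_time p g))%N.

Definition nkinks p : nat := #|[set i : 'I_n | extra_kink p i]|.

Lemma valley_kink p (i : 'I_n) :
  (~~ rises p (p i) && rises p (p i).+1) =
  ~~ [exists k : 'I_n, (k < i)%N &&
        (((p k).+1 == p i :> nat) || (p k == (p i).+1 :> nat))].
Proof.
rewrite /rises leqNgt ltn_ord /= flip_timeK; apply/idP/idP.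
  case/andP=> lo hi; apply/existsP => -[k /andP[ki /orP[/eqP e|/eqP e]]].
    by move: lo; rewrite -e /= flip_timeK ki.
  by move: hi; rewrite -e leqNgt ltn_ord flip_timeK ltnNge (ltnW ki).
move/existsPn => nok; apply/andP; split.
  apply/negP => /andP[pi0].
  have /(flip_timeP p)[k ek ->] : ((p i).-1 < n)%N.
    by apply: leq_ltn_trans (leq_pred _) (ltn_ord _).
  by move=> ki; move: (nok k); rewrite ki /= ek prednK // eqxx.
case: (leqP n (p i).+1) => //= /(flip_timeP p)[k ek ->].
rewrite ltnNge leq_eqVlt; apply/negP => /orP[/eqP/val_inj eki|ki].
  by move: ek; rewrite eki; lia.
by move: (nok k); rewrite ki /= ek eqxx orbT.
Qed.

(** The extra one is the initial flip, always a local minimum. *)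
Lemma valleys_nkinks p : (0 < n)%N -> valleys n (rises p) = (nkinks p).+1.
Proof.
move=> n0; rewrite /valleys big_mkord (reindex_inj (@perm_inj _ p)) /=.
rewrite (bigD1 (Ordinal n0)) //= valley_kink.
have -> : [exists k : 'I_n, (k < Ordinal n0)%N &&
    (((p k).+1 == p (Ordinal n0) :> nat)
     || (p k == (p (Ordinal n0)).+1 :> nat))] = false.
  by apply/existsP => -[k].
rewrite /= add1n; congr _.+1; rewrite /nkinks -sum1_card [RHS]big_mkcond /=.
rewrite [RHS](bigD1 (Ordinal n0)) //= inE /extra_kink /= add0n.
apply: eq_bigr => i ni0; rewrite valley_kink inE.
rewrite (_ : (0 < i)%N = true) /=; first by case: [exists k, _].
by rewrite lt0n; apply: contraNN ni0 => /eqP e; apply/eqP/val_inj.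
Qed.

End FlipTime.

(** In the inverse permutation, appending a last flip at vertex [x] inserts
the new maximal flip time at position [x]; [bump x] is the shift that makes
room for it. *)
Lemma flip_time_lift n (p : 'S_n) (x : 'I_n.+1) :
  flip_time (lift_perm ord_max x p) x = n /\
  forall g, (g < n)%N ->
    flip_time (lift_perm ord_max x p) (bump x g) = flip_time p g.
Proof.
split=> [|g /(flip_timeP p)[k ek ->]].
  by rewrite -{2}(lift_perm_id ord_max x p) flip_timeK.
rewrite -ek.
have -> : bump x (p k) = lift_perm ord_max x p (lift ord_max k) :> nat.
  by rewrite lift_perm_lift.
by rewrite flip_timeK lift_max.
Qed.

Lemma flip_time_lt n (p : 'S_n) g : (0 < n)%N -> (flip_time p g < n)%N.
Proof.
by move=> n0; rewrite /flip_time; case: insubP => [u _ _|_]; rewrite ?ltn_ord.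
Qed.

Lemma nkinks_lift n (p : 'S_n) (x : 'I_n.+1) : (0 < n)%N ->
  nkinks (lift_perm ord_max x p) = (nkinks p + creates n (rises p) x)%N.
Proof.
move=> n0; apply: succn_inj; rewrite -addSn -!valleys_nkinks //.
have [tx tb] := flip_time_lift p x.
have tlt g : (g < x)%N -> flip_time (lift_perm ord_max x p) g = flip_time p g.
  move=> gx; rewrite -tb ?(leq_trans gx (leq_ord x)) //.
  by rewrite /bump leqNgt gx.
have tge g : (x <= g < n)%N ->
    flip_time (lift_perm ord_max x p) g.+1 = flip_time p g.
  by case/andP=> xg gn; rewrite -tb // /bump xg.
have xn := leq_ord x.
apply: valleys_insert => //; rewrite /rises ?leqnn ?ltnn //.
- by rewrite leqNgt n0.
- move=> g gx; have gn := leq_trans gx xn.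
  rewrite [(n < g)%N]ltnNge (ltnW gn) [(n <= g)%N]leqNgt gn /=.
  by rewrite !tlt //; apply: leq_ltn_trans (leq_pred _) gx.
- rewrite ltnNge xn tx /=; case: posnP => //= x0.
  by rewrite tlt ?flip_time_lt // ltn_predL.
- rewrite ltnS /= tx eqn_leq xn /=; case: (leqP n x) => //= lt_xn.
  by rewrite tge ?leqnn // ltnNge ltnW // flip_time_lt.
- move=> g gx; rewrite ltnS; case: (leqP n g) => //= gn.
  rewrite [RHS]/= (leq_trans _ gx) // tge ?gn ?(ltnW gx) //.
  by case: g gx gn => //= g gx gn; rewrite tge // -ltnS gx ltnW.
Qed.

Lemma sum_creates_perm n (p : 'S_n) : (0 < n)%N ->
  (\sum_(x < n.+1) creates n (rises p) x + (nkinks p).+1.*2 = n.+1)%N.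
Proof.
move=> n0; rewrite -valleys_nkinks // sum_creates // /rises ?leqnn //.
by rewrite leqNgt n0.
Qed.

Lemma lift_perm_last_bij n :
  bijective (fun xp : 'I_n.+1 * 'S_n => lift_perm ord_max xp.1 xp.2).
Proof.
apply: inj_card_bij => [[x p] [y q] /= e|]; last first.
  by rewrite card_prod !card_Sn card_ord factS.
have exy : x = y by rewrite -(lift_perm_id ord_max x p) e lift_perm_id.
congr (_, _) => //; apply/permP => k; apply: (@lift_inj _ x).
by rewrite -(lift_perm_lift ord_max) e exy lift_perm_lift.
Qed.

Lemma sum_perm_lift (V : nmodType) n (F : 'S_n.+1 -> V) :
  \sum_(p : 'S_n.+1) F p =
  \sum_(p : 'S_n) \sum_(x < n.+1) F (lift_perm ord_max x p).
Proof.
rewrite exchange_big pair_big /=.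
by rewrite (reindex _ (onW_bij _ (lift_perm_last_bij n))).
Qed.

(** * Formal power series *)

Section Coef.
Variable R : comNzRingType.
Implicit Types f g : {fps R}.

Lemma coef_fpsCM (c : R) f n : (fpsC c * f) n = c * f n.
Proof.
rewrite coef_fpsM big_ord_recl subn0 big1 ?addr0 // => i _.
by rewrite mul0r.
Qed.

Lemma coef_fpsXM f n : (fpsX * f) n = if n is k.+1 then f k else 0.
Proof.
case: n => [|n]; first by rewrite coef0_fpsM mul0r.
rewrite coef_fpsM !big_ord_recl big1 => [|i _]; last by rewrite mul0r.
by rewrite /= mul0r mul1r add0r addr0 subSS subn0.
Qed.

Lemma coef_fpsXnM f k n :
  (fpsX ^+ k * f) n = if (k <= n)%N then f (n - k)%N else 0.
Proof.
elim: k n => [|k IHk] n; first by rewrite mul1r subn0.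
by rewrite exprS -mulrA coef_fpsXM; case: n.
Qed.

Lemma coef_fpsXn k n : (fpsX ^+ k : {fps R}) n = (n == k)%:R.
Proof.
rewrite -[_ ^+ k]mulr1 coef_fpsXnM coef_fps1 subn_eq0.
by case: ltngtP.
Qed.

Definition geom (c : R) : {fps R} := Fps (fun n => c ^+ n).

Lemma geomP (c : R) : geom c * (1 - fpsC c * fpsX) = 1.
Proof.
apply/fpsP => n; rewrite mulrBr mulr1 mulrCA [geom c * _]mulrC.
rewrite coef_fpsB coef_fpsCM coef_fpsXM coef_fps1.
by case: n => [|n] /=; rewrite ?mulr0 ?subr0 // -exprS subrr.
Qed.

End Coef.

(** * The derivation theta *)

Section Theta.
Variable R : comNzRingType.
Implicit Types f g : {fps R}.

(** The Euler operator v d/dv. *)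
Definition euler f : {fps R} := Fps (fun n => f n *+ n).

Fact euler_is_zmod_morphism : zmod_morphism euler.
Proof. by move=> f g; apply/fpsP => n /=; rewrite mulrnBl. Qed.

HB.instance Definition _ := GRing.isZmodMorphism.Build {fps R} {fps R} euler
  euler_is_zmod_morphism.

Lemma eulerM f g : euler (f * g) = euler f * g + f * euler g.
Proof.
apply/fpsP => n; rewrite coef_fpsD !coef_fpsM /= -sumrMnl -big_split /=.
apply: eq_bigr => i _; rewrite mulrnAl mulrnAr -mulrnDr.
by rewrite subnKC // -ltnS ltn_ord.
Qed.

(** The derivation in the recurrence of the kink polynomials; on s, where
1 - v = s^2, its factor 2 (1 - v) cancels the denominator of ds/dv. *)
Definition theta f : {fps R} := (1 - fpsX) *+ 2 * euler f.

Fact theta_is_zmod_morphism : zmod_morphism theta.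
Proof. by move=> f g; rewrite /theta raddfB mulrBr. Qed.

HB.instance Definition _ := GRing.isZmodMorphism.Build {fps R} {fps R} theta
  theta_is_zmod_morphism.

Lemma thetaM f g : theta (f * g) = theta f * g + f * theta g.
Proof. by rewrite /theta eulerM; ring. Qed.

Lemma theta1 : theta 1 = 0.
Proof.
have := thetaM 1 1; rewrite !mul1r mulr1 => /(canLR (addKr _)).
by rewrite addNr.
Qed.

Lemma thetaX : theta fpsX = (1 - fpsX) *+ 2 * fpsX.
Proof.
rewrite /theta; congr (_ * _); apply/fpsP => n /=.
by case: eqP => [->|]; rewrite ?mul0rn.
Qed.

(** Eigenvector form of the logarithmic derivative: with [theta f = c * f] it
needs no division. *)
Lemma theta_logX f c k : theta f = c * f -> theta (f ^+ k) = c *+ k * f ^+ k.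
Proof.
move=> fE; elim: k => [|k IHk]; first by rewrite theta1 mulr0n mul0r.
by rewrite exprS thetaM fE IHk; ring.
Qed.

Lemma theta_logM f g c d : theta f = c * f -> theta g = d * g ->
  theta (f * g) = (c + d) * (f * g).
Proof. by move=> fE gE; rewrite thetaM fE gE; ring. Qed.

End Theta.

(** * Kink polynomials *)

Definition kink_poly n : {fps rat} := \sum_(p : 'S_n) fpsX ^+ nkinks p.

Lemma coef_kink_poly n d : kink_poly n d = #|kinkF n d|%:R.
Proof.
rewrite coef_fps_sum -sum1_card natr_sum [RHS]big_mkcond /=.
apply: eq_bigr => p _; rewrite coef_fpsXn inE eq_sym /nkinks.
by case: eqP.
Qed.

Lemma kink_poly1 : kink_poly 1 = 1.
Proof.
rewrite /kink_poly (eq_bigr (fun=> 1)) => [|p _].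
  by rewrite sumr_const card_Sn.
rewrite (_ : nkinks p = 0%N) //; apply/eqP; rewrite cards_eq0.
by apply/eqP/setP => i; rewrite !inE ord1.
Qed.

(** A history with k extra kinks has 2 (k + 1) extensions with k of them,
and its other n + 1 - 2 (k + 1) extensions have k + 1; the dependence on k
is what theta accounts for. *)
Lemma kink_poly_rec n : (0 < n)%N ->
  kink_poly n.+1 =
  (2%:R + n%:R * fpsX - fpsX) * kink_poly n + theta (kink_poly n).
Proof.
move=> n0; rewrite /kink_poly sum_perm_lift raddf_sum mulr_sumr -big_split /=.
apply: eq_bigr => p _; rewrite (theta_logX _ (thetaX _)).
under eq_bigr => x _ do rewrite nkinks_lift // exprD.
have Xb (b : bool) : fpsX ^+ b = 1 + b%:R * (fpsX - 1) :> {fps rat}.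
  by case: b; rewrite ?mul1r ?mul0r ?addr0 // addrC subrK.
under eq_bigr => x _ do rewrite Xb.
rewrite -mulr_sumr big_split sumr_const card_ord -mulr_suml -natr_sum /=.
have /(congr1 (fun k => k%:R : {fps rat})) := sum_creates_perm p n0.
rewrite natrD => /(canRL (addrK _)) ->.
by rewrite -muln2; ring.
Qed.

(** * Eulerian sums *)

(** [root1v], [inv1Droot] and [zeta] are the series s, w and z. *)
Definition root1v : {fps rat} := fps_sqrt (1 - fpsX).
Definition inv1Droot : {fps rat} := (1 + root1v)^-1.
Definition zeta : {fps rat} := (1 - root1v) * inv1Droot.

Lemma sqr_root : root1v ^+ 2 = 1 - fpsX.
Proof. by rewrite sqr_fps_sqrt. Qed.

Lemma inv1DrootK : inv1Droot * (1 + root1v) = 1.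
Proof. by apply: mulVr. Qed.

Lemma X_inv1Droot : fpsX * inv1Droot = 1 - root1v.
Proof.
have -> : 1 - root1v = (1 - root1v) * (inv1Droot * (1 + root1v)).
  by rewrite inv1DrootK mulr1.
by rewrite -[fpsX](subKr 1) -sqr_root; ring.
Qed.

(** This is what makes [zeta ^+ m] divisible by v^m. *)
Lemma zetaE : zeta = fpsX * inv1Droot ^+ 2.
Proof. by rewrite /zeta -X_inv1Droot; ring. Qed.

Lemma theta_root : theta root1v = - fpsX * root1v.
Proof.
(* Differentiate s^2 = 1 - v. *)
have e : euler root1v * root1v *+ 2 = - fpsX.
  have := congr1 (@euler _) sqr_root; rewrite expr2 eulerM raddfB /=.
  have -> : euler (1 : {fps rat}) = 0.
    by apply/fpsP => -[|n] //=; rewrite mul0rn.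
  have -> : euler fpsX = fpsX :> {fps rat}.
    by apply/fpsP => n /=; case: eqP => [->|]; rewrite ?mul0rn.
  by rewrite sub0r => <-; ring.
by rewrite -e /theta -sqr_root; ring.
Qed.

Lemma theta_inv1Droot : theta inv1Droot = root1v * (1 - root1v) * inv1Droot.
Proof.
(* Differentiate w (1 + s) = 1 and use v w = 1 - s. *)
have := congr1 (@theta _) inv1DrootK; rewrite theta1 thetaM raddfD /= theta1.
rewrite add0r theta_root => e.
have {e} : (theta inv1Droot * (1 + root1v)
            + inv1Droot * (- fpsX * root1v)) * inv1Droot = 0.
  by rewrite e mul0r.
rewrite mulrDl -mulrA [_ * inv1Droot]mulrC inv1DrootK mulr1.
move=> /eqP; rewrite addr_eq0 => /eqP ->.
by rewrite -X_inv1Droot; ring.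
Qed.

Lemma theta_zeta : theta zeta = root1v *+ 2 * zeta.
Proof.
rewrite zetaE (theta_logM (c := (1 - fpsX) *+ 2)
                          (d := root1v * (1 - root1v) *+ 2)).
- by rewrite -sqr_root; ring.
- by rewrite thetaX; ring.
- by apply: theta_logX; exact: theta_inv1Droot.
Qed.

(** The truncation of H_n to its first [m] terms. *)
Definition euler_sum n m : {fps rat} :=
  \sum_(k < m) 2%:R ^+ n.+1 * k.+1%:R ^+ n
                 * (root1v ^+ n.+1 * inv1Droot ^+ 2 * zeta ^+ k).

(** The factor k + 1 gained by the k-th term comes from theta acting on
z^k, which gives 2 s k, and on the powers of s and w, which gives the rest
once v is replaced by 1 - s^2. *)
Lemma euler_sum_rec n m : euler_sum n.+1 m =
  (2%:R + n%:R * fpsX - fpsX) * euler_sum n m + theta (euler_sum n m).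
Proof.
rewrite /euler_sum raddf_sum /= mulr_sumr -big_split /=; apply: eq_bigr => k _.
set T := root1v ^+ n.+1 * _ * _.
have -> : theta (2%:R ^+ n.+1 * k.+1%:R ^+ n * T) =
   (2%:R ^+ n.+1 * k.+1%:R ^+ n) *
   ((- fpsX *+ n.+1 + root1v * (1 - root1v) *+ 2 + root1v *+ 2 *+ k) * T).
  rewrite -!natrX -natrM !mulr_natl raddfMn /=; congr (_ *+ _).
  by do 2?apply: theta_logM; apply: theta_logX;
    [exact: theta_root | exact: theta_inv1Droot | exact: theta_zeta].
have -> : fpsX = 1 - root1v ^+ 2 by rewrite sqr_root subKr.
rewrite (exprS _ n.+1) (exprS k.+1%:R n) (exprS root1v n.+1) /T.
move: (2%:R ^+ n.+1) (k.+1%:R ^+ n) (root1v ^+ n.+1) => c d e.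
ring.
Qed.

Lemma one_sub_zeta : 1 - zeta = root1v * inv1Droot *+ 2.
Proof. by rewrite /zeta -{1}inv1DrootK; ring. Qed.

(** Here 2 s w = 1 - z turns the sum into (1 - z)^2 sum_k (k + 1) z^k. *)
Lemma euler_sum1 m : euler_sum 1 m = 1 - zeta ^+ m * (1 + m%:R * (1 - zeta)).
Proof.
have -> : euler_sum 1 m = (1 - zeta) ^+ 2 * \sum_(k < m) k.+1%:R * zeta ^+ k.
  rewrite /euler_sum mulr_sumr; apply: eq_bigr => k _.
  by rewrite one_sub_zeta; ring.
elim: m => [|m IHm].
  by rewrite big_ord0 mulr0 expr0 mul0r addr0 mulr1 subrr.
rewrite big_ord_recr mulrDr IHm (exprS zeta m) /= -natr1.
move: (zeta ^+ m) (m%:R : {fps rat}) => c d.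
by ring.
Qed.

(** The error term stays divisible by v^m along the recurrence because theta
maps the ideal of v^m into itself. *)
Lemma kink_poly_euler_sum n m :
  exists g, kink_poly n.+1 = euler_sum n.+1 m + fpsX ^+ m * g.
Proof.
elim: n => [|n [g IHn]].
  exists (inv1Droot ^+ 2 ^+ m * (1 + m%:R * (1 - zeta))).
  by rewrite kink_poly1 euler_sum1 zetaE mulrA -exprMn subrK.
exists ((2%:R + n.+1%:R * fpsX - fpsX + (1 - fpsX) *+ 2 *+ m) * g + theta g).
rewrite kink_poly_rec // euler_sum_rec IHn raddfD /= thetaM.
rewrite (theta_logX _ (thetaX _)).
by ring.
Qed.

(** * Telescoping the summands *)

Section Algebra.
Variable R : comNzRingType.

(** The linear factor of the numerator is half of (1 - s) Da + (1 + s) Db, so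
that each part cancels one factor of the denominator; z (1 + s)^2 = v absorbs
the power of v. *)
Lemma summandE (s t v z a b Da Db : R) j :
    z * (1 + s) = 1 - s -> s ^+ 2 = 1 - v -> a * Da = 1 -> b * Db = 1 ->
    Da = 1 - (2 * j)%:R * t * s -> Db = 1 - (2 * (j + 1))%:R * t * s ->
  4%:R * t ^+ 2 * s * (1 - (1 + 2 * j)%:R * s * t - t * (1 - v)) * v ^+ j =
  2%:R * s * t ^+ 2 * z ^+ j * (z * a * b ^+ 2 + a ^+ 2 * b)
  * ((1 + s) ^+ (1 + 2 * j) * Da ^+ 2 * Db ^+ 2).
Proof.
move=> zs s2 aD bD DaE DbE.
have -> : v ^+ j = z ^+ j * (1 + s) ^+ (2 * j).
  rewrite exprM -exprMn; congr (_ ^+ _).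
  by rewrite [(1 + s) ^+ 2]expr2 mulrA zs -[v](subKr 1) -s2; ring.
rewrite exprD.
transitivity (2%:R * s * t ^+ 2 * z ^+ j * (1 + s) ^+ (2 * j) *
   (z * (1 + s) * (a * Da) * (b * Db) ^+ 2 * Da +
    (1 + s) * (a * Da) ^+ 2 * (b * Db) * Db)); last by ring.
rewrite zs aD bD -s2 DaE DbE; move: (z ^+ j) ((1 + s) ^+ _) => c d; ring.
Qed.

(** For consecutive poles the combination (m + 1) Da - m Db of the
denominators is 1. *)
Lemma pole_mul (a b Da Db X m : R) : a * Da = 1 -> b * Db = 1 ->
  Da = 1 - m * X -> Db = 1 - (m + 1) * X -> a * b = (m + 1) * b - m * a.
Proof.
move=> aD bD DaE DbE.
transitivity ((m + 1) * b * (a * Da) - m * a * (b * Db)); last first.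
  by rewrite aD bD !mulr1.
by rewrite DaE DbE; ring.
Qed.

(** The remainder of the telescoping after [m] terms, with [Z] standing for
z^m and [a] for e_m: double summation by parts of the second difference of
j^2 e_j leaves this boundary term. *)
Definition rest (s t z Z a m : R) : R :=
  2%:R * s * t ^+ 2 * (Z * m * (a ^+ 2 + (m + 1) * a - z * m * a)).

(** The relation between [a] and [b] turns both cubic products into
combinations of a, b, a^2, b^2, after which the powers of [z] match. *)
Lemma rest_step (s t w z Z a b m : R) :
    a * b = (m + 1) * b - m * a -> 1 - z = s * w *+ 2 ->
  2%:R * s * t ^+ 2 * Z * (z * a * b ^+ 2 + a ^+ 2 * b) =
  8%:R * (s ^+ 3 * w ^+ 2 * Z) * (m + 1) ^+ 2 * (t ^+ 2 * b)
  + (rest s t z (z * Z) b (m + 1) - rest s t z Z a m).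
Proof.
move=> ab zE.
have a2b : a ^+ 2 * b = (m + 1) ^+ 2 * b - m * (m + 1) * a - m * a ^+ 2.
  transitivity ((m + 1) * (a * b) - m * a ^+ 2); last by rewrite ab; ring.
  transitivity (a * (a * b)); first by ring.
  by rewrite {1}ab; ring.
have ab2 : a * b ^+ 2 = (m + 1) * b ^+ 2 - m * (m + 1) * b + m ^+ 2 * a.
  transitivity ((m + 1) * b ^+ 2 - m * (a * b)); last by rewrite ab; ring.
  transitivity ((a * b) * b); first by ring.
  by rewrite {1}ab; ring.
rewrite -[z * a * _]mulrA ab2 a2b.
transitivity (2%:R * s * t ^+ 2 * Z * (1 - z) ^+ 2 * (m + 1) ^+ 2 * b
    + (rest s t z (z * Z) b (m + 1) - rest s t z Z a m)).
  by rewrite /rest; ring.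
by rewrite zE; ring.
Qed.

End Algebra.

Section Sum.
Local Notation t := (tvar rat).
Local Notation v := (vvar rat).
Local Notation s := sqrt1v.
Local Notation z := (fpsC zeta).
Local Notation w := (fpsC inv1Droot).

(** The series e_j = 1 / (1 - 2 j s t). *)
Definition pole j : {fps {fps rat}} := geom ((2 * j)%:R * root1v).

Lemma poleP j : pole j * (1 - (2 * j)%:R * t * s) = 1.
Proof.
rewrite -[RHS](geomP ((2 * j)%:R * root1v)) rmorphM rmorph_nat.
by rewrite -!mulrA [t * s]mulrC.
Qed.

Definition summand (j : nat) : {fps {fps rat}} :=
  (4%:R * t ^+ 2 * s * (1 - (1 + 2 * j)%:R * s * t - t * (1 - v)) * v ^+ j)
       / ((1 + s) ^+ (1 + 2 * j)
          * (1 - (2 * j)%:R * t * s) ^+ 2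
          * (1 - (2 * (j + 1))%:R * t * s) ^+ 2).

Lemma zeta_mul1D : z * (1 + s) = 1 - s.
Proof.
rewrite -[1 in LHS](rmorph1 (@fpsC {fps rat})) -rmorphD -rmorphM /=.
by rewrite /zeta -mulrA inv1DrootK mulr1 rmorphB rmorph1.
Qed.

Lemma one_sub_z : 1 - z = s * w *+ 2.
Proof.
rewrite -(rmorph1 (@fpsC {fps rat})) -rmorphB -rmorphM -rmorphMn /=.
by rewrite one_sub_zeta.
Qed.

Lemma summand_pole j : summand j = 2%:R * s * t ^+ 2 * z ^+ j *
  (z * pole j * pole j.+1 ^+ 2 + pole j ^+ 2 * pole j.+1).
Proof.
have bD : pole j.+1 * (1 - (2 * (j + 1))%:R * t * s) = 1.
  by rewrite addn1 poleP.
rewrite /summand (summandE zeta_mul1D sqr_sqrt1v (poleP j) bD erefl erefl).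
by rewrite mulrK // summand_denom_unit.
Qed.

Lemma sum_summand m : \sum_(j < m) summand j =
  \sum_(k < m) fpsC (8%:R * (root1v ^+ 3 * inv1Droot ^+ 2 * zeta ^+ k)
                     * k.+1%:R ^+ 2) * (t ^+ 2 * pole k.+1)
  + rest s t z (z ^+ m) (pole m) m%:R.
Proof.
elim: m => [|m IHm]; first by rewrite !big_ord0 /rest; ring.
rewrite !big_ord_recr /= IHm summand_pole.
rewrite (rest_step (m := m%:R) _ _ _ one_sub_z); last first.
  apply: (pole_mul (X := 2%:R * t * s) (poleP _) (poleP _)); rewrite natrM.
    by ring.
  by rewrite -addn1 natrD; ring.
have -> : fpsC (8%:R * (root1v ^+ 3 * inv1Droot ^+ 2 * zeta ^+ m)
                * m.+1%:R ^+ 2) =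
    8%:R * (s ^+ 3 * w ^+ 2 * z ^+ m) * m.+1%:R ^+ 2.
  (* Abstracting the series keeps the morphism laws from unfolding them. *)
  rewrite (_ : s = fpsC root1v) //; move: root1v inv1Droot zeta => a b c.
  by rewrite !(rmorphXn, rmorph_nat, rmorphM).
rewrite -exprS natr1 -!addrA; congr (_ + _).
move: (rest s t z (z ^+ m) _ _) => r; move: (rest s t z _ _ _) => r'.
by rewrite addrCA [r + _]addrC subrK.
Qed.

Lemma coef_sum_summand m n : exists g,
  (\sum_(j < m) summand j) n =
    (if (2 <= n)%N then euler_sum n m else 0) + fpsX ^+ m * g.
Proof.
have pole_coef k : (t ^+ 2 * pole k.+1) n =
    (if (2 <= n)%N then ((2 * k.+1)%:R * root1v) ^+ (n - 2) else 0).
  by rewrite coef_fpsXnM.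
rewrite sum_summand coef_fpsD coef_fps_sum.
eexists; congr (_ + _).
  under eq_bigr => k _ do rewrite coef_fpsCM pole_coef.
  case: (leqP 2 n) => [n2|_]; last by rewrite big1 // => k _; rewrite mulr0.
  rewrite -{2}(subnK n2); apply: eq_bigr => k _.
  move: (n - 2)%N => l.
  rewrite addn2 natrM !exprMn !(exprS _ l.+2) !(exprS _ l.+1) !(exprS _ l).
  move: (root1v ^+ l) (k.+1%:R ^+ l) (2%:R ^+ l) => c d e; ring.
have -> : rest s t z (z ^+ m) (pole m) m%:R = fpsC (fpsX ^+ m) *
     (fpsC (inv1Droot ^+ 2 ^+ m) * rest s t z 1 (pole m) m%:R).
  rewrite mulrA -rmorphM -exprMn -zetaE rmorphXn /rest /=; ring.
by rewrite coef_fpsCM.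
Qed.

End Sum.

(** * The generating function *)

Theorem theorem3 :
  let t := tvar rat in
  let v := vvar rat in
  let s := sqrt1v in
  fps2_sums_to
    (fun j : nat =>
       (4%:R * t ^+ 2 * s * (1 - (1 + 2 * j)%:R * s * t - t * (1 - v)) * v ^+ j)
       / ((1 + s) ^+ (1 + 2 * j)
          * (1 - (2 * j)%:R * t * s) ^+ 2
          * (1 - (2 * (j + 1))%:R * t * s) ^+ 2))
    kinkG.
Proof.
(* The first [m] summands settle all coefficients of v^d with d < m. *)
move=> t v s n d; exists d.+1 => m lt_dm.
have [g] := coef_sum_summand m n; rewrite {}/summand => ->.
rewrite coef_fpsD coef_fpsXnM [(m <= d)%N]leqNgt lt_dm addr0 /=.
case: n => [|[|n]] //=; rewrite -coef_kink_poly.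
have [h ->] := kink_poly_euler_sum n.+1 m.
by rewrite coef_fpsD coef_fpsXnM [(m <= d)%N]leqNgt lt_dm addr0.
Qed.
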